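(* Let $\{(X_h^{(t)})_{h=1}^H\}_{t\in[T]}$ be i.i.d. copies of a possibly time-inhomogeneous Markov chain on a finite state space $\mathcal Z$ with initial distribution $\mu$ ($X_1^{(t)}\sim\mu$) and transition matrices $(P_h)_{h\ge1}$ ($X_{h+1}^{(t)}\sim P_h(X_h^{(t)},\cdot)$). Assume $\mu$ and all $P_h$ are $\eta$-regular for some $\eta\ge1$, and each $P_h$ admits a stationary distribution $\nu_h$. Let $\phi_h:\mathcal Z\to\mathbb R$, $h\in[H]$, be bounded functions. Then for all $\rho\ge0$, $$\mathbb P\Big[\sum_{t=1}^T\sum_{h=1}^H\big(\phi_h(X_h^{(t)})-\mathbb E_\mu[\phi_h(X_h^{(t)})]\big)>\rho\Big]\le\exp\Big(-\frac{\rho^2}{2TH\,V_{\mu,P,\phi}+\frac23M_{P,\phi}\rho}\Big),$$ where $V_{\mu,P,\phi}=(1+\sqrt2\,\eta(2\eta-1))^2\max_{z\in\mathcal Z}\max_{1\le\ell\le h\le H}\mathrm{Var}_{P_{\ell-1}(z,\cdot)}[\phi_h]$ and $M_{P,\phi}=(2\eta-1)\max_{h\in[H]}\|\phi_h\|_\infty$, with the convention $P_0(z,\cdot)=\mu$.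
   Context: A probability distribution $\nu$ on $\mathcal Z$ is $\eta$-regular if $\max_{z_1,z_2}\nu(z_1)/\nu(z_2)\le\eta$. A transition matrix $P$ on $\mathcal Z$ is $\eta$-regular if $\max_{x,y,z\in\mathcal Z}\max\{P(y|x)/P(z|x),\,P(x|y)/P(x|z)\}\le\eta$ (here $P(y|x)=P(x,y)$). $\mathrm{Var}_{\nu}[\phi]$ denotes the variance of $\phi(Z)$ for $Z\sim\nu$, and $\mathbb E_\mu[\phi_h(X_h^{(t)})]$ is the expectation when $X_1^{(t)}\sim\mu$. *)

(* Defs.v *)
From HB Require Import structures.
From mathcomp Require Import all_boot all_order all_algebra.
From mathcomp Require Import reals sequences exp.
Set Implicit Arguments. Unset Strict Implicit. Unset Printing Implicit Defensive.
Import Order.TTheory GRing.Theory Num.Theory.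
Local Open Scope ring_scope.

Section Defs.
Variables (R : realType) (Z : finType).

Definition is_distr (nu : Z -> R) : Prop :=
  (forall z, 0 <= nu z) /\ \sum_z nu z = 1.

Definition is_stoch (P : Z -> Z -> R) : Prop :=
  forall x, is_distr (P x).

Definition distr_regular (eta : R) (nu : Z -> R) : Prop :=
  (forall z, 0 < nu z) /\ forall z1 z2, nu z1 / nu z2 <= eta.

Definition trans_regular (eta : R) (P : Z -> Z -> R) : Prop :=
  (forall x y, 0 < P x y) /\
  forall x y z, P x y / P x z <= eta /\ P y x / P z x <= eta.

Definition is_stationary (P : Z -> Z -> R) (nu : Z -> R) : Prop :=
  is_distr nu /\ forall y, \sum_x nu x * P x y = nu y.

Definition varD (nu : Z -> R) (f : Z -> R) : R :=
  \sum_y nu y * (f y - \sum_w nu w * f w) ^+ 2.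

(* Convention (0-based steps): step 0 is X_1 ~ mu; step k+1 is drawn from
   P (k+1) applied at step k, i.e. P k is the paper's P_k (k >= 1). *)
Definition marginal (mu : Z -> R) (P : nat -> Z -> Z -> R) : nat -> Z -> R :=
  fix m k := match k with
             | 0 => mu
             | k'.+1 => fun y => \sum_x m k' x * P k x y
             end.

Definition Pconv (mu : Z -> R) (P : nat -> Z -> Z -> R) (k : nat) (z : Z) : Z -> R :=
  if k is 0 then mu else P k z.

Definition path_at (H : nat) (x : {ffun 'I_H -> Z}) (d : Z) (n : nat) : Z :=
  if insub n is Some j then x j else d.

Definition pathP (mu : Z -> R) (P : nat -> Z -> Z -> R) (H : nat)
    (x : {ffun 'I_H -> Z}) : R :=
  \prod_(i < H) (if val i == 0%N then mu (x i)
                 else P (val i) (path_at x (x i) (val i).-1) (x i)).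

Definition centered_sum (mu : Z -> R) (P : nat -> Z -> Z -> R) (T H : nat)
    (phi : 'I_H -> Z -> R) (xs : {ffun 'I_T -> {ffun 'I_H -> Z}}) : R :=
  \sum_(t < T) \sum_(h < H)
     (phi h (xs t h) - \sum_z marginal mu P (val h) z * phi h z).

Definition tail_prob (mu : Z -> R) (P : nat -> Z -> Z -> R) (T H : nat)
    (phi : 'I_H -> Z -> R) (rho : R) : R :=
  \sum_(xs : {ffun 'I_T -> {ffun 'I_H -> Z}} | rho < centered_sum mu P phi xs)
     \prod_(t < T) pathP mu P (xs t).

Definition Vconst (mu : Z -> R) (P : nat -> Z -> Z -> R) (H : nat)
    (phi : 'I_H -> Z -> R) (eta : R) : R :=
  (1 + Num.sqrt 2 * (eta * (2 * eta - 1))) ^+ 2 *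
  \big[Num.max/0]_(z : Z) \big[Num.max/0]_(h < H) \big[Num.max/0]_(k < (val h).+1)
     varD (Pconv mu P k z) (phi h).

Definition Mconst (H : nat) (phi : 'I_H -> Z -> R) (eta : R) : R :=
  (2 * eta - 1) * \big[Num.max/0]_(h < H) \big[Num.max/0]_(z : Z) `|phi h z|.

End Defs.

(* Main.v *)
Require Import Defs.
From HB Require Import structures.
From mathcomp Require Import all_boot all_order all_algebra.
From mathcomp Require Import reals sequences exp.
From mathcomp Require Import topology normedtype ring lra.
Import Order.TTheory GRing.Theory Num.Theory.
Local Open Scope ring_scope.

(** Let [G x] be the expected sum of the [phi_h] over the remaining steps given
    that the current state is [x].  The centered sum is a sum of martingale
    differences [D = G X - E G X].  Column regularity [P x y <= eta * P x' y]
    makes each step contract oscillations by [1 - 1/eta] and gives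
    [osc (P f) <= (eta - 1) * std f].  Summing geometric series, with
    [m = max |phi_h|] and [v] the maximal variance,
    [|D| <= 2 * eta * m <= 2 * M] and [Var D <= (1 + eta * (eta - 1))^2 * v].

    The bound on [|D|] is twice the constant [M] of the theorem.  The loss is
    absorbed by the variance term: for [|x| <= y < 6], comparing power series,
    [exp x <= 1 + x + 18/5 * (x^2 / 2) / (1 - y/6)], whose denominator at
    [y = 2 * lam * M] is the Bernstein one for [M], and
    [18/5 * (1 + eta * (eta - 1))^2 <= (1 + sqrt 2 * eta * (2 * eta - 1))^2].
    Chernoff's bound then concludes. *)

(** * A power series bound for the exponential *)

Lemma geometric_sum_le {R : realFieldType} (d : R) n :
  0 <= d < 1 -> \sum_(i < n) d ^+ i <= (1 - d)^-1.
Proof.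
move=> /andP[d0 d1]; have d1' : 0 < 1 - d by rewrite subr_gt0.
rewrite -[leRHS]mul1r ler_pdivlMr //.
have -> : (\sum_(i < n) d ^+ i) * (1 - d) = 1 - d ^+ n.
  by have := subrX1 d n => h; rewrite -[RHS]opprB h; ring.
by rewrite lerBlDr lerDl exprn_ge0.
Qed.

(* The ratio [2 * 6 ^ k / (k + 2)!] peaks at [k = 3, 4], with value 18/5. *)
Lemma fact_lower_bound {R : realFieldType} k :
  2 * 6 ^+ k <= 18 / 5 * (k.+2)`!%:R :> R.
Proof.
have [|k3] := ltnP k 3.
  by case: k => [|[|[|//]]] _; rewrite !factS fact0 /=; lra.
rewrite -(subnK k3); elim: (k - 3)%N => [|j IH].
  by rewrite !factS fact0 /=; lra.
rewrite addSn exprS factS natrM.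
have j6 : 6 <= (j + 3).+3%:R :> R by rewrite ler_nat !addnS addn0.
have F0 : 0 <= ((j + 3).+2)`!%:R :> R by rewrite ler0n.
by nra.
Qed.

Lemma expR_le_bernstein {R : realType} (x y : R) : `|x| <= y -> y < 6 ->
  expR x <= 1 + x + 9 / 5 * x ^+ 2 / (1 - y / 6).
Proof.
move=> xy y6; have y0 : 0 <= y by apply: le_trans xy.
rewrite /expR; apply: limr_le; first exact: is_cvg_series_exp_coeff.
(* Only partial sums with at least two terms matter for the limit; these contain [1 + x], which is
   split off. *)
exists 2%N => //= n; case: n => [//|[//|n]] _.
rewrite /series /= big_mkord !big_ord_recl /exp_coeff /= expr0 expr1 fact0.
rewrite /bump /= divr1 addrA !divr1 lerD2l.
have step (i : 'I_n) : x ^+ (1 + (1 + i)) / (1 + (1 + i))`!%:R <=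
    9 / 5 * x ^+ 2 * (y / 6) ^+ i.
  rewrite !add1n.
  have fp : 0 < (i.+2)`!%:R :> R by rewrite ltr0n fact_gt0.
  rewrite ler_pdivrMr //; have := @fact_lower_bound R i => fl.
  have -> : x ^+ i.+2 = x ^+ 2 * x ^+ i by rewrite -exprD.
  have -> : 9 / 5 * x ^+ 2 * (y / 6) ^+ i * (i.+2)`!%:R =
      x ^+ 2 * (y ^+ i * (9 / 5 * (i.+2)`!%:R / 6 ^+ i)).
    by rewrite exprMn exprVn; ring.
  rewrite ler_wpM2l ?sqr_ge0 // -[leLHS]mulr1.
  apply: (@le_trans _ _ (y ^+ i * 1)).
    by rewrite !mulr1 (le_trans (ler_norm _)) // normrX lerXn2r ?nnegrE.
  rewrite ler_wpM2l ?exprn_ge0 // ler_pdivlMr ?exprn_gt0 //; lra.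
apply: (le_trans (ler_sum _ (fun i _ => step i))).
rewrite -mulr_sumr; apply: ler_wpM2l; first by have := sqr_ge0 x; lra.
by apply: geometric_sum_le; apply/andP; split; lra.
Qed.

(** * Moments and oscillations under one distribution *)

Section Expectation.
Context {R : realType} {Z : finType}.
Implicit Types (nu : Z -> R) (f g : Z -> R).

Definition expect nu f := \sum_z nu z * f z.

Lemma expectD nu f g : expect nu (fun z => f z + g z) = expect nu f + expect nu g.
Proof. by rewrite /expect -big_split; apply: eq_bigr => z _; rewrite mulrDr. Qed.

Lemma expectZ nu a f : expect nu (fun z => a * f z) = a * expect nu f.
Proof. by rewrite /expect mulr_sumr; apply: eq_bigr => z _; rewrite mulrCA. Qed.

Lemma expect_cst nu a : is_distr nu -> expect nu (fun=> a) = a.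
Proof. by move=> [_ s]; rewrite /expect -mulr_suml s mul1r. Qed.

Lemma expect_sum nu (I : finType) (F : I -> Z -> R) :
  expect nu (fun z => \sum_i F i z) = \sum_i expect nu (F i).
Proof.
rewrite /expect exchange_big; apply: eq_bigr => z _; exact: mulr_sumr.
Qed.

Lemma le_expect nu f g : is_distr nu -> (forall z, f z <= g z) ->
  expect nu f <= expect nu g.
Proof. by move=> [p _] fg; apply: ler_sum => z _; rewrite ler_wpM2l. Qed.

Lemma expect_le nu f a : is_distr nu -> (forall z, f z <= a) -> expect nu f <= a.
Proof. by move=> nuD fa; rewrite -[leRHS](expect_cst _ _ nuD) le_expect. Qed.

Lemma norm_expect nu f : is_distr nu -> `|expect nu f| <= expect nu (fun z => `|f z|).
Proof.
move=> [p _]; apply: le_trans (ler_norm_sum _ _ _) _.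
by apply: ler_sum => z _; rewrite normrM (ger0_norm (p z)).
Qed.

Lemma norm_sub_expect_le nu f d x : is_distr nu ->
  (forall y z, f y - f z <= d) -> `|f x - expect nu f| <= d.
Proof.
move=> nuD fd; rewrite -(expect_cst _ (f x) nuD).
have -> : expect nu (fun=> f x) - expect nu f = expect nu (fun z => f x - f z).
  rewrite expectD; congr (_ + _); rewrite /expect -sumrN.
  by apply: eq_bigr => z _; rewrite mulrN.
apply: (le_trans (norm_expect _ _ nuD)); apply: expect_le => // z.
by rewrite ler_norml fd andbT lerNl opprB fd.
Qed.

(** The gap between the second moment of [f] and the square of the mean of [|f|] is the variance of
    [|f|]. *)
Lemma expect_norm_sqr_le nu f s : is_distr nu -> 0 <= s ->
  expect nu (fun z => f z ^+ 2) <= s ^+ 2 -> expect nu (fun z => `|f z|) <= s.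
Proof.
move=> nuD s0 fs; set a := expect nu _.
have a0 : 0 <= a by apply: sumr_ge0 => z _; rewrite mulr_ge0 ?nuD.1.
rewrite -(ler_pXn2r (n := 2)) ?nnegrE //.
apply: le_trans fs; rewrite -subr_ge0.
have -> : expect nu (fun z => f z ^+ 2) - a ^+ 2 =
          expect nu (fun z => (`|f z| - a) ^+ 2).
  have -> : expect nu (fun z => (`|f z| - a) ^+ 2) =
     expect nu (fun z => f z ^+ 2 + ((- 2 * a) * `|f z| + a ^+ 2)).
    by apply: eq_bigr => z _; rewrite -(real_normK (num_real (f z))); congr *%R; ring.
  by rewrite expectD expectD expectZ expect_cst // -/a; ring.
by apply: sumr_ge0 => z _; rewrite mulr_ge0 ?sqr_ge0 ?nuD.1.
Qed.

(* Minorization: [p >= q / eta], so [p - q / eta] is a measure of mass [1 - 1/eta]. *)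
Lemma expect_contraction (eta d : R) (p q : Z -> R) f :
  0 < eta -> is_distr p -> is_distr q -> (forall z, q z <= eta * p z) ->
  (forall y z, f y - f z <= d) ->
  expect p f - expect q f <= (1 - eta^-1) * d.
Proof.
move=> eta0 pD qD qp fd.
have -> : expect p f - expect q f =
   \sum_z (p z - eta^-1 * q z) * (f z - expect q f).
  set m := expect q f.
  under eq_bigr => z _.
    have -> : (p z - eta^-1 * q z) * (f z - m) =
      p z * f z - eta^-1 * (q z * f z) - m * p z + m * eta^-1 * q z by ring.
    over.
  rewrite !(big_split, sumrN) /= -!mulr_sumr pD.2 qD.2.
  by rewrite -/(expect p f) -/(expect q f) -/m; ring.
have <- : \sum_z (p z - eta^-1 * q z) = 1 - eta^-1.
  by rewrite big_split sumrN -mulr_sumr pD.2 qD.2 mulr1.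
rewrite mulr_suml; apply: ler_sum => z _; apply: ler_wpM2l.
  by rewrite subr_ge0 ler_pdivrMl.
exact: le_trans (ler_norm _) (norm_sub_expect_le _ _ _ _ qD fd).
Qed.

(** Since [p] and [q] have equal mass, [f] may be centered at its [q]-mean. The two ratio bounds
    give [|p - q| <= (eta - 1) * q], and a mean absolute deviation is at most a standard
    deviation. *)
Lemma expect_sub_le_std (eta s : R) (p q : Z -> R) f :
  1 <= eta -> 0 <= s -> is_distr p -> is_distr q ->
  (forall z, p z <= eta * q z) -> (forall z, q z <= eta * p z) ->
  varD q f <= s ^+ 2 -> expect p f - expect q f <= (eta - 1) * s.
Proof.
move=> eta1 s0 pD qD pq qp vf; set m := expect q f.
have -> : expect p f - m = \sum_z (p z - q z) * (f z - m).
  under eq_bigr => z _.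
    have -> : (p z - q z) * (f z - m) =
      p z * f z - q z * f z - m * p z + m * q z by ring.
    over.
  rewrite !(big_split, sumrN) /= -!mulr_sumr pD.2 qD.2.
  by rewrite -/(expect p f) -/(expect q f) -/m; ring.
have h : expect q (fun z => `|f z - m|) <= s by apply: expect_norm_sqr_le.
apply: (@le_trans _ _ ((eta - 1) * expect q (fun z => `|f z - m|))); last first.
  by rewrite ler_wpM2l // subr_ge0.
rewrite mulr_sumr; apply: ler_sum => z _; apply: le_trans (ler_norm _) _.
rewrite normrM mulrA ler_wpM2r // ler_norml.
have := pq z; have := qp z; have := pD.1 z; have := qD.1 z => *.
apply/andP; split; nra.
Qed.

(** This is the triangle inequality for standard deviations, obtained pointwise by a weighted Young
    inequality. *)
Lemma varD_add_le nu f g q s : is_distr nu -> 0 <= q -> 0 <= s ->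
  varD nu f <= s ^+ 2 -> (forall y z, g y - g z <= q * s) ->
  varD nu (fun z => f z + g z) <= ((1 + q) * s) ^+ 2.
Proof.
move=> nuD q0 s0 vf gd.
have -> : varD nu (fun z => f z + g z) =
  expect nu (fun z => ((f z - expect nu f) + (g z - expect nu g)) ^+ 2).
  apply: eq_bigr => z _; congr (_ * _ ^+ 2).
  rewrite -/(expect nu _) expectD; ring.
set c := (1 + q) * q * s ^+ 2.
apply: (@le_trans _ _ (expect nu (fun z => (1 + q) * (f z - expect nu f) ^+ 2 + c))).
  apply: le_expect => // z; rewrite /c.
  have := norm_sub_expect_le _ _ _ z nuD gd.
  set a := f z - _; set b := g z - _; rewrite ler_norml => /andP[b1 b2].
  have bb : b ^+ 2 <= (q * s) ^+ 2 by nra.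
  (* Young's inequality for [|a|] and [s], as [|b| <= q * s]; this form remains valid at [s = 0]. *)
  have ab : 2 * a * b <= q * (a ^+ 2 + s ^+ 2).
    have [a0|a0] := leP 0 a.
      have : a * b <= a * (q * s) by rewrite ler_wpM2l.
      have : 0 <= q * (a - s) ^+ 2 by rewrite mulr_ge0 ?sqr_ge0.
      nra.
    have : - a * - b <= - a * (q * s) by rewrite ler_wpM2l; lra.
    have : 0 <= q * (a + s) ^+ 2 by rewrite mulr_ge0 ?sqr_ge0.
    nra.
  nra.
rewrite expectD expectZ expect_cst // /c.
have : (1 + q) * expect nu (fun z => (f z - expect nu f) ^+ 2) <= (1 + q) * s ^+ 2.
  by rewrite ler_wpM2l // addr_ge0.
nra.
Qed.

Lemma mgf_bernstein nu f (lam M w : R) : is_distr nu ->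
  0 <= lam -> lam * M < 3 -> (forall z, `|f z - expect nu f| <= 2 * M) ->
  varD nu f <= w ->
  expect nu (fun z => expR (lam * f z)) <=
    expR (lam * expect nu f + 9 / 5 * lam ^+ 2 * w / (1 - lam * M / 3)).
Proof.
move=> nuD lam0 lamM fM vf; set m := expect nu f.
rewrite expRD.
have -> : expect nu (fun z => expR (lam * f z)) =
    expR (lam * m) * expect nu (fun z => expR (lam * (f z - m))).
  rewrite -expectZ; apply: eq_bigr => z _; rewrite -expRD; congr (_ * expR _); ring.
(* By [1 + u <= expR u] a polynomial bound suffices; the linear term of the expansion has mean
   zero. *)
rewrite ler_wpM2l ?expR_ge0 //; apply: le_trans (expR_ge1Dx _).
set K := 9 / 5 * lam ^+ 2 / (1 - lam * M / 3).
have K0 : 0 <= K by rewrite /K !mulr_ge0 ?invr_ge0 ?sqr_ge0 ?ler0n //; lra.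
apply: (@le_trans _ _ (expect nu (fun z => (1 + lam * (f z - m)) + K * (f z - m) ^+ 2))).
  apply: le_expect => // z.
  have := @expR_le_bernstein R (lam * (f z - m)) (lam * (2 * M)).
  have -> : 9 / 5 * (lam * (f z - m)) ^+ 2 / (1 - lam * (2 * M) / 6) = K * (f z - m) ^+ 2.
    rewrite /K; have -> : lam * (2 * M) / 6 = lam * M / 3 by field.
    by field; lra.
  by apply; [rewrite normrM (ger0_norm lam0) ler_wpM2l|lra].
rewrite expectD expectD expect_cst // !expectZ expectD expect_cst // -/m subrr mulr0 addr0 lerD2l.
have -> : 9 / 5 * lam ^+ 2 * w / (1 - lam * M / 3) = K * w by rewrite /K; field; lra.
by rewrite ler_wpM2l.
Qed.

End Expectation.

(** * Conditional means along the chain and its moment generating function *)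

Section Chain.
Context {R : realType} {Z : finType}.
Implicit Types (mu : Z -> R) (P : nat -> Z -> Z -> R) (f : Z -> R).

(** Once the first state [z] is removed, the rest is a chain with these matrices and initial
    distribution [P 1 z]. *)
Definition shift P : nat -> Z -> Z -> R := fun k => P k.+1.

(** The conditional mean of [f] taken [k.+1] steps, not [k], after the state [x]. *)
Definition fwd P f k x := expect (marginal (P 1%N x) (shift P) k) f.

(** [marginal] recurses on the last transition, whereas the inductions below peel off the first. *)
Lemma marginalS mu P k y :
  marginal mu P k.+1 y = \sum_x mu x * marginal (P 1%N x) (shift P) k y.
Proof.
elim: k y => [//|k IH] y.
transitivity (\sum_x marginal mu P k.+1 x * P k.+2 x y) => //.
under eq_bigr do rewrite IH mulr_suml.
rewrite exchange_big; apply: eq_bigr => x _ /=; rewrite mulr_sumr.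
by apply: eq_bigr => z _; rewrite mulrA.
Qed.

Lemma expect_marginalS mu P k f :
  expect (marginal mu P k.+1) f = expect mu (fwd P f k).
Proof.
rewrite /fwd /expect; under eq_bigr do rewrite marginalS mulr_suml.
rewrite exchange_big; apply: eq_bigr => x _ /=; rewrite mulr_sumr.
by apply: eq_bigr => z _; rewrite mulrA.
Qed.

Lemma fwdS P k f x : fwd P f k.+1 x = expect (P 1%N x) (fwd (shift P) f k).
Proof. exact: expect_marginalS. Qed.

Definition mixing (eta : R) P := forall k, is_stoch (P k.+1) /\
  forall x x' y, P k.+1 x y <= eta * P k.+1 x' y.

Lemma mixing_shift eta P : mixing eta P -> mixing eta (shift P).
Proof. by move=> mP k; apply: mP. Qed.

Lemma fwd_osc_le (eta d : R) k P f : 0 < eta -> mixing eta P ->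
  (forall y z, f y - f z <= d) ->
  forall x y, fwd P f k x - fwd P f k y <= (1 - eta^-1) ^+ k.+1 * d.
Proof.
move=> eta0; elim: k P => [|k IH] P mP fd x y; have [PD Peta] := mP 0%N.
  by rewrite expr1; apply: (expect_contraction eta _ (P 1%N x) (P 1%N y)).
rewrite !fwdS exprS -mulrA.
apply: (expect_contraction eta _ (P 1%N x) (P 1%N y)) => // z w.
by apply: IH => //; apply: mixing_shift.
Qed.

(** The last transition, the one just before [f] is evaluated, turns standard deviation into
    oscillation; the [k] earlier ones contract it. *)
Lemma fwd_osc_le_std (eta s : R) k P f : 1 <= eta -> 0 <= s -> mixing eta P ->
  (forall z, varD (P k.+1 z) f <= s ^+ 2) ->
  forall x y, fwd P f k x - fwd P f k y <= (1 - eta^-1) ^+ k * ((eta - 1) * s).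
Proof.
move=> eta1 s0; elim: k P => [|k IH] P mP vf x y; have [PD Peta] := mP 0%N.
  by rewrite mul1r; apply: (expect_sub_le_std eta s (P 1%N x) (P 1%N y)).
rewrite !fwdS exprS -mulrA.
apply: (expect_contraction eta _ (P 1%N x) (P 1%N y)) => //.
  exact: lt_le_trans eta1.
by move=> z w; apply: IH => //; apply: mixing_shift.
Qed.

Definition fcons n (z : Z) (x : {ffun 'I_n -> Z}) : {ffun 'I_n.+1 -> Z} :=
  [ffun i => oapp x z (unlift ord0 i)].

Lemma fcons0 n z (x : {ffun 'I_n -> Z}) : fcons n z x ord0 = z.
Proof. by rewrite ffunE unlift_none. Qed.

Lemma fcons_lift n z (x : {ffun 'I_n -> Z}) i : fcons n z x (lift ord0 i) = x i.
Proof. by rewrite ffunE liftK. Qed.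

Lemma big_fcons n (F : {ffun 'I_n.+1 -> Z} -> R) :
  \sum_x F x = \sum_z \sum_x F (fcons n z x).
Proof.
rewrite pair_bigA (reindex (fun p => fcons n p.1 p.2)) //; apply: onW_bij.
exists (fun x : {ffun 'I_n.+1 -> Z} => (x ord0, [ffun i => x (lift ord0 i)])).
  move=> [z x] /=; rewrite fcons0; congr pair.
  by apply/ffunP => i; rewrite ffunE fcons_lift.
move=> x; apply/ffunP => i /=; case: (unliftP ord0 i) => [j|] ->.
  by rewrite fcons_lift ffunE.
by rewrite fcons0.
Qed.

Lemma path_at_fcons n z (x : {ffun 'I_n -> Z}) d k :
  path_at (fcons n z x) d k.+1 = path_at x d k.
Proof.
rewrite /path_at; have [kn|kn] := ltnP k n.
  have kn' : (k.+1 < n.+1)%N by [].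
  rewrite (insubT (fun i => i < n.+1)%N kn') (insubT (fun i => i < n)%N kn).
  rewrite -(fcons_lift _ z x) /=; congr (fcons n z x _); exact: val_inj.
by rewrite !insubF // ltnNge ?ltnS kn.
Qed.

Lemma pathP_fcons mu P n z (x : {ffun 'I_n -> Z}) :
  Defs.pathP mu P (fcons n z x) = mu z * Defs.pathP (P 1%N z) (shift P) x.
Proof.
rewrite /Defs.pathP big_ord_recl /= fcons0; congr (_ * _); apply: eq_bigr => -[i lti] _.
rewrite fcons_lift /= /bump /= add1n add0n; case: i lti => [|i] lti /=.
  (* The second state is drawn from the row [P 1 z], the initial distribution of the remaining
     chain. *)
  by rewrite /path_at insubT /= (_ : Sub _ _ = ord0) ?fcons0 //; apply: val_inj.
by rewrite path_at_fcons.
Qed.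

(** Induction on the length: given the first state [z], the induction hypothesis replaces the later
    terms by their conditional mean [U z] at the cost [n * c]. Averaging [expR (lam * G z)] over [z]
    then costs one more [c]. *)
Lemma mgf_chain (eta s m lam M c : R) n mu P (phi : 'I_n -> Z -> R) :
  1 <= eta -> 0 <= s -> 0 <= lam -> lam * M < 3 -> m * eta <= M ->
  9 / 5 * lam ^+ 2 * ((1 + eta * (eta - 1)) * s) ^+ 2 / (1 - lam * M / 3) <= c ->
  is_distr mu -> mixing eta P -> (forall h z, `|phi h z| <= m) ->
  (forall (h : 'I_n) k z, (k <= h)%N -> varD (Pconv mu P k z) (phi h) <= s ^+ 2) ->
  \sum_(x : {ffun 'I_n -> Z}) Defs.pathP mu P x * expR (lam * \sum_(h < n) phi h (x h)) <=
  expR (lam * (\sum_(h < n) expect (marginal mu P h) (phi h)) + n%:R * c).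
Proof.
move=> eta1 s0 lam0 lamM mM cP; elim: n mu P phi => [|n IH] mu P phi muD mP phim vphi.
  rewrite (eq_bigr (fun=> 1)) => [|x _]; last first.
    by rewrite /Defs.pathP !big_ord0 mulr0 expR0 mulr1.
  by rewrite sumr_const card_ffun card_ord expn0 big_ord0 mulr0 mul0r addr0 expR0.
have eta0 : 0 < eta by apply: lt_le_trans eta1.
have delta01 : 0 <= 1 - eta^-1 < 1.
  by rewrite subr_ge0 invf_le1 // eta1 ltrBlDr ltrDl invr_gt0.
have geo k : \sum_(i < k) (1 - eta^-1) ^+ i <= eta.
  by apply: le_trans (geometric_sum_le _ _ delta01) _; rewrite opprB addrC subrK invrK.
pose U x := \sum_(i < n) fwd P (phi (lift ord0 i)) i x.
pose G x := phi ord0 x + U x.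
have EG : \sum_(h < n.+1) expect (marginal mu P h) (phi h) = expect mu G.
  rewrite big_ord_recl expectD expect_sum; congr (_ + _).
  by apply: eq_bigr => i _; rewrite -expect_marginalS.
have m2 h y z : phi h y - phi h z <= 2 * m.
  have := phim h y; have := phim h z; rewrite !ler_norml => /andP[? ?] /andP[? ?]; lra.
have Gosc y z : G y - G z <= 2 * M.
  have m0 : 0 <= m by apply: le_trans (phim ord0 y).
  apply: (@le_trans _ _ (2 * m * \sum_(i < n.+1) (1 - eta^-1) ^+ i)); last first.
    by have := geo n.+1; nra.
  have -> : G y - G z = (phi ord0 y - phi ord0 z) + (U y - U z) by rewrite /G; ring.
  (* [phi ord0] has oscillation [2 * m] and takes the term of exponent [0] in the geometric sum. *)
  rewrite big_ord_recl mulrDr expr0 mulr1 lerD // /U -sumrB mulr_sumr.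
  apply: ler_sum => i _; rewrite mulrC; exact: fwd_osc_le.
have Uosc y z : U y - U z <= eta * (eta - 1) * s.
  apply: (@le_trans _ _ ((\sum_(i < n) (1 - eta^-1) ^+ i) * ((eta - 1) * s))).
    rewrite /U -sumrB mulr_suml; apply: ler_sum => i _.
    by apply: fwd_osc_le_std => // w; apply: (vphi (lift ord0 i) i.+1).
  by rewrite -mulrA ler_wpM2r // mulr_ge0 // subr_ge0.
have vG : varD mu G <= ((1 + eta * (eta - 1)) * s) ^+ 2.
  apply: varD_add_le => //; first by rewrite mulr_ge0 ?subr_ge0 // ltW.
  (* At [k = 0] the hypothesis bounds the variance under [mu], but still asks for a state; with [Z]
     empty the variance is an empty sum. *)
  case: (pickP (@predT Z)) => [z _|Z0]; first exact: (vphi ord0 0%N z).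
  by rewrite /varD big_pred0 ?sqr_ge0.
rewrite big_fcons EG.
apply: (@le_trans _ _ (\sum_z mu z * (expR (lam * G z) * expR (n%:R * c)))).
  apply: ler_sum => z _.
  under eq_bigr => x _.
    rewrite pathP_fcons big_ord_recl fcons0 mulrDr expRD.
    under eq_bigr do rewrite fcons_lift.
    rewrite -mulrA [X in _ * X]mulrCA.
    over.
  rewrite -!mulr_sumr ler_wpM2l ?muD.1 // /G mulrDr expRD -mulrA ler_wpM2l ?expR_ge0 //.
  rewrite -expRD; apply: IH.
  - exact: (mP 0%N).1.
  - exact: mixing_shift.
  - by move=> h w; apply: phim.
  - by move=> h [|k] w kh; [apply: (vphi (lift ord0 h) 1%N z)|apply: (vphi (lift ord0 h) k.+2)].
under eq_bigr do rewrite mulrA.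
rewrite -mulr_suml -[n.+1]addn1 natrD mulrDl mul1r addrA addrAC expRD ler_wpM2r ?expR_ge0 //.
apply: le_trans (mgf_bernstein _ _ _ _ _ muD lam0 lamM _ vG) _.
  by move=> z; apply: norm_sub_expect_le.
by rewrite ler_expR lerD2l.
Qed.

End Chain.

(** * Chernoff's bound and the choice of [lam] *)

Section Tail.
Context {R : realType} {Z : finType}.
Implicit Types (mu : Z -> R) (P : nat -> Z -> Z -> R).

Lemma trans_regular_col (eta : R) (P : Z -> Z -> R) x x' y :
  trans_regular eta P -> P x y <= eta * P x' y.
Proof. by move=> [p r]; rewrite -ler_pdivrMr //; have [] := r y x x'. Qed.

Lemma pathP_ge0 mu P H (x : {ffun 'I_H -> Z}) : is_distr mu ->
  (forall k, is_stoch (P k.+1)) -> 0 <= Defs.pathP mu P x.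
Proof.
move=> muD PD; apply: prodr_ge0 => -[[|i] lti] _ /=; first exact: muD.1.
exact: (PD i _).1.
Qed.

Lemma tail_prob_chernoff mu P (T H : nat) (phi : 'I_H -> Z -> R) (lam rho c : R) :
  0 <= lam -> is_distr mu -> (forall k, is_stoch (P k.+1)) ->
  \sum_(x : {ffun 'I_H -> Z}) Defs.pathP mu P x * expR (lam * \sum_(h < H) phi h (x h)) <=
    expR (lam * (\sum_(h < H) expect (marginal mu P h) (phi h)) + c) ->
  tail_prob mu P T phi rho <= expR (- (lam * rho) + T%:R * c).
Proof.
move=> lam0 muD PD mgf; set E := \sum_(h < H) _ in mgf.
pose F x := Defs.pathP mu P x * expR (lam * ((\sum_(h < H) phi h (x h)) - E)).
have F1 : \sum_x F x <= expR c.
  rewrite /F; under eq_bigr do rewrite mulrBr expRD mulrA.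
  by rewrite -mulr_suml expRN ler_pdivrMr ?expR_gt0 // -expRD addrC.
have q0 (xs : {ffun 'I_T -> {ffun 'I_H -> Z}}) : 0 <= \prod_(t < T) Defs.pathP mu P (xs t).
  by apply: prodr_ge0 => t _; apply: pathP_ge0.
apply: (@le_trans _ _ (expR (- (lam * rho)) *
    \sum_(xs : {ffun 'I_T -> {ffun 'I_H -> Z}}) \prod_(t < T) F (xs t))).
  rewrite /tail_prob big_mkcond mulr_sumr; apply: ler_sum => xs _.
  have -> : \prod_(t < T) F (xs t) =
      \prod_(t < T) Defs.pathP mu P (xs t) * expR (lam * centered_sum mu P phi xs).
    rewrite big_split; congr (_ * _).
    rewrite -(big_morph expR (@expRD R) (@expR0 R)) -mulr_sumr.
    by congr (expR (_ * _)); apply: eq_bigr => t _; rewrite sumrB.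
  (* The indicator of the tail event is at most [expR (lam * (S - rho))], with [S] the centered
     sum. *)
  rewrite mulrCA -expRD; case: ifP => S; last by rewrite mulr_ge0 ?expR_ge0.
  rewrite -[leLHS]mulr1 ler_wpM2l // -[leLHS]expR0 ler_expR.
  by have := ler_wpM2l lam0 (ltW S); lra.
(* Independence of the copies: the sum over families of paths factors into a [T]-th power. *)
rewrite expRD ler_wpM2l ?expR_ge0 // -(bigA_distr_bigA (fun=> F)) prodr_const card_ord.
rewrite expRM_natl lerXn2r ?nnegrE ?expR_ge0 //.
by apply: sumr_ge0 => x _; rewrite mulr_ge0 ?expR_ge0 ?pathP_ge0.
Qed.

(* Optimizing over [lam] gives [lam = rho / (A + M * rho / 3)]; when [A = 0] this
   would make [lam * M = 3], and half of it is enough. *)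
Lemma bernstein_optimize (p A M rho : R) : 0 <= A -> 0 <= M -> 0 <= rho ->
  (forall lam, 0 <= lam -> lam * M < 3 ->
     p <= expR (- (lam * rho) + A * (lam ^+ 2 / (2 * (1 - lam * M / 3))))) ->
  p <= expR (- (rho ^+ 2 / (2 * A + 2 / 3 * M * rho))).
Proof.
move=> A0 M0 rho0 bound.
have B0 : 0 <= M * rho by rewrite mulr_ge0.
have [A_gt0|] := ltP 0 A.
  have D0 : 0 < A + M * rho / 3 by lra.
  have lM : rho / (A + M * rho / 3) * M < 3.
    by rewrite mulrAC ltr_pdivrMr //; lra.
  apply: le_trans (bound (rho / (A + M * rho / 3)) _ lM) _.
    by rewrite divr_ge0 // ltW.
  rewrite ler_expR le_eqVlt; apply/orP; left; apply/eqP; field.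
  by rewrite !gt_eqF //; lra.
move=> A_le0; have A_0 : A = 0 by apply: le_anti; rewrite A0 A_le0.
have [M_gt0|M_le0] := ltP 0 M.
  have lM : 3 / (2 * M) * M < 3.
    by rewrite mulrAC ltr_pdivrMr; lra.
  apply: le_trans (bound (3 / (2 * M)) _ lM) _; first by rewrite divr_ge0 // mulr_ge0.
  rewrite A_0 mul0r mulr0 add0r addr0 ler_expR.
  have [->|rho_neq0] := eqVneq rho 0; first by rewrite !mulr0 expr0n mul0r.
  rewrite le_eqVlt; apply/orP; left; apply/eqP; field.
  by rewrite rho_neq0 gt_eqF.
have M_0 : M = 0 by apply: le_anti; rewrite M0 M_le0.
(* The target exponent has denominator [0], hence is [0], and [lam = 0] already gives [p <= 1]. *)
apply: le_trans (bound 0 _ _) _ => //; first by rewrite mul0r ltr0n.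
by rewrite A_0 M_0 !mul0r !mulr0 !mul0r add0r invr0 mulr0 addr0.
Qed.

End Tail.

(** * Comparison of constants and conclusion *)

Lemma variance_constant_le {R : rcfType} (eta : R) : 1 <= eta ->
  18 / 5 * (1 + eta * (eta - 1)) ^+ 2 <=
  (1 + Num.sqrt 2 * (eta * (2 * eta - 1))) ^+ 2.
Proof.
move=> eta1; have sqrt2 : 7 / 5 <= Num.sqrt 2 :> R.
  have -> : 7 / 5 = Num.sqrt ((7 / 5) ^+ 2) :> R.
    by rewrite sqrtr_sqr ger0_norm //; lra.
  by rewrite ler_wsqrtr //; lra.
have q0 : 0 <= eta * (2 * eta - 1) by rewrite mulr_ge0; lra.
(* As [18/5 <= (19/10)^2], it is enough to compare the bases, using [7/5] for the square root. *)
apply: (@le_trans _ _ ((19 / 10 * (1 + eta * (eta - 1))) ^+ 2)).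
  by rewrite exprMn ler_wpM2r ?sqr_ge0 //; lra.
rewrite ler_pXn2r ?nnegrE //.
- apply: (@le_trans _ _ (1 + 7 / 5 * (eta * (2 * eta - 1)))); first by nra.
  by rewrite lerD2l ler_wpM2r.
- by have := sqr_ge0 (eta - 1); lra.
- by apply: addr_ge0 => //; apply: mulr_ge0 => //; apply: sqrtr_ge0.
Qed.

Theorem theorem9 (R : realType) (Z : finType) (T H : nat) (eta : R)
    (mu : Z -> R) (P : nat -> Z -> Z -> R) (phi : 'I_H -> Z -> R) (rho : R) :
  1 <= eta ->
  is_distr mu -> distr_regular eta mu ->
  (forall h, (0 < h)%N -> is_stoch (P h)) ->
  (forall h, (0 < h)%N -> trans_regular eta (P h)) ->
  (forall h, (0 < h)%N -> exists nu, is_stationary (P h) nu) ->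
  0 <= rho ->
  tail_prob mu P T phi rho <=
    expR (- (rho ^+ 2 /
      (2 * T%:R * H%:R * Vconst mu P phi eta + 2 / 3 * Mconst phi eta * rho))).
Proof.
move=> eta1 muD _ PD Preg _ rho0.
rewrite /Vconst /Mconst.
set K := (1 + _) ^+ 2; set v := \big[Num.max/0]_(z : Z) _.
set m := \big[Num.max/0]_(h < H) _.
have v0 : 0 <= v by apply: bigmax_ge_id.
have m0 : 0 <= m by apply: bigmax_ge_id.
have K0 : 0 <= K by apply: sqr_ge0.
have phim h z : `|phi h z| <= m.
  by apply: (bigmax_sup h) => //; apply: (bigmax_sup z).
have phiv (h : 'I_H) k z : (k <= h)%N -> varD (Pconv mu P k z) (phi h) <= v.
  move=> kh; apply: (bigmax_sup z) => //; apply: (bigmax_sup h) => //.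
  exact: (bigmax_sup (Ordinal (kh : (k < h.+1)%N))).
have mP : mixing eta P.
  move=> k; split=> [|x x' y]; first exact: PD.
  exact/trans_regular_col/Preg.
have -> : 2 * T%:R * H%:R * (K * v) = 2 * (T%:R * H%:R * (K * v)) by ring.
apply: bernstein_optimize => //; [by rewrite mulr_ge0 // mulr_ge0|by apply: mulr_ge0 => //; lra|].
move=> lam lam0 lamM; set B := 1 - lam * _ / 3.
have B0 : 0 < B by rewrite /B; lra.
have -> : T%:R * H%:R * (K * v) * (lam ^+ 2 / (2 * B)) =
          T%:R * (H%:R * (lam ^+ 2 * (K * v) / (2 * B))) by ring.
apply: tail_prob_chernoff => //; first by move=> k; apply: PD.
apply: (mgf_chain eta (Num.sqrt v) m lam ((2 * eta - 1) * m)) => //.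
- exact: sqrtr_ge0.
- by rewrite mulrC ler_wpM2r //; lra.
- have := variance_constant_le _ eta1; rewrite -/K => Kle.
  rewrite exprMn sqr_sqrtr // -/B.
  (* Doubling numerator and denominator turns [9/5] into the [18/5] of [variance_constant_le]. *)
  have -> : 9 / 5 * lam ^+ 2 * ((1 + eta * (eta - 1)) ^+ 2 * v) / B =
    lam ^+ 2 * (18 / 5 * (1 + eta * (eta - 1)) ^+ 2 * v) / (2 * B).
    by field; rewrite gt_eqF.
  rewrite ler_wpM2r ?invr_ge0 ?mulr_ge0 ?(ltW B0) //.
  by rewrite ler_wpM2l ?sqr_ge0 // ler_wpM2r.
- by move=> h k z kh; rewrite sqr_sqrtr //; apply: phiv.
Qed.
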